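(* Let $\mathcal A$ be an associative unital algebra over $\mathbb C$, let $q\in\mathbb C$, $q\neq 0$, and $C_1,C_2,C_3\in\mathbb C$, and let $X,Y,Z\in\mathcal A$ satisfy the Askey--Wilson relations $$XY-qYX=Z+C_3,\qquad YZ-qZY=X+C_1,\qquad ZX-qXZ=Y+C_2 .$$ Define polynomials $U_n,V_n,W_n\in\mathbb C[x]$ by $U_0=1$, $V_0=W_0=0$ and $$U_{n+1}=(1-q)xU_n+q^{-1}V_n,\quad V_{n+1}=-U_n+(1-q^{-1})xV_n,\quad W_{n+1}=-C_3U_n+C_1q^{-1}V_n .$$ Then for all $n\ge 0$ $$\mathrm{ad}_Y^n X=U_n(Y)X+V_n(Y)Z+W_n(Y),$$ and consequently, as power series in $t$, $$e^{tY}Xe^{-tY}=E_1(t;Y)X+E_2(t;Y)Z+E_0(t;Y),$$ where $E_1,E_2$ are the solution of the linear system $$\dot E_1(t;x)=(1-q)xE_1+q^{-1}E_2,\qquad \dot E_2(t;x)=-E_1+(1-q^{-1})xE_2,\qquad E_1(0;x)=1,\ E_2(0;x)=0,$$ and $$E_0(t;x)=-C_3\int_0^tE_1(\tau;x)\,d\tau+C_1q^{-1}\int_0^tE_2(\tau;x)\,d\tau .$$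
   Context: $\mathrm{ad}_Y B=[Y,B]=YB-BY$, and $\mathrm{ad}_Y^n$ is its $n$-fold iterate. The expression $e^{tY}Xe^{-tY}$ means the formal power series $\sum_{n\ge0}\frac{t^n}{n!}\mathrm{ad}_Y^nX$. The functions $E_i(t;x)$ are power series in $t$ with coefficients polynomial in $x$ and $E_i(t;Y)$ is obtained by substituting $Y$ for $x$ in each coefficient; the dot denotes $d/dt$. Scalars are identified with multiples of the unit. *)

(* Defs.v *)
From HB Require Import structures.
From mathcomp Require Import all_boot all_order all_algebra.
From mathcomp Require Import reals.
From mathcomp Require Export complex.

Set Implicit Arguments.
Unset Strict Implicit.
Unset Printing Implicit Defensive.

Import GRing.Theory.
Local Open Scope ring_scope.

Definition ad (A : nzRingType) (Y B : A) : A := Y * B - B * Y.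

Definition askey_wilson (K : fieldType) (A : algType K) (q C1 C2 C3 : K)
    (X Y Z : A) : Prop :=
  [/\ X * Y - q *: (Y * X) = Z + C3%:A,
      Y * Z - q *: (Z * Y) = X + C1%:A &
      Z * X - q *: (X * Z) = Y + C2%:A].

Section AdPolynomials.
Variables (K : fieldType) (q C1 C3 : K).

Fixpoint U_ (n : nat) : {poly K} :=
  if n is m.+1 then (1 - q) *: ('X * U_ m) + q^-1 *: V_ m else 1
with V_ (n : nat) : {poly K} :=
  if n is m.+1 then - U_ m + (1 - q^-1) *: ('X * V_ m) else 0.

Definition W_ (n : nat) : {poly K} :=
  if n is m.+1 then (- C3) *: U_ m + (C1 * q^-1) *: V_ m else 0.

End AdPolynomials.

(* A formal power series in t with coefficients in T, given by its sequence of
   coefficients: f stands for \sum_n f n * t ^ n.  The pointwise operations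
   f \+ g, k \*: f, a \*o f and f multiplied by a on the right, a \o* f, are
   the sum and the products by an element independent of t. *)
Definition fps (T : Type) : Type := nat -> T.

(* d/dt *)
Definition fps_deriv (T : nmodType) (f : fps T) : fps T :=
  fun n => f n.+1 *+ n.+1.

(* The integral from 0 to t. *)
Definition fps_int (K : fieldType) (T : lmodType K) (f : fps T) : fps T :=
  fun n => if n is m.+1 then (m.+1%:R : K)^-1 *: f m else 0.

(* E(t; Y), for E(t; x) with coefficients polynomial in x. *)
Definition fps_eval (K : fieldType) (A : algType K) (E : fps {poly K}) (Y : A) :
    fps A :=
  fun n => horner_alg Y (E n).

(* e^{tY} X e^{-tY} *)
Definition exp_conj (K : fieldType) (A : algType K) (Y X : A) : fps A :=
  fun n => (n`!%:R : K)^-1 *: iter n (ad Y) X.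

Definition E_system (K : fieldType) (q : K) (E1 E2 : fps {poly K}) : Prop :=
  [/\ fps_deriv E1 = ((1 - q) *: 'X) \*o E1 \+ q^-1 \*: E2,
      fps_deriv E2 = \- E1 \+ ((1 - q^-1) *: 'X) \*o E2,
      E1 0%N = 1 &
      E2 0%N = 0].

Definition E0_series (K : fieldType) (q C1 C3 : K) (E1 E2 : fps {poly K}) :
    fps {poly K} :=
  (- C3) \*: fps_int E1 \+ (C1 * q^-1) \*: fps_int E2.

(* Main.v *)
Require Import Defs.
From HB Require Import structures.
From mathcomp Require Import all_boot all_order all_algebra.
From mathcomp Require Import reals boolp.

Set Implicit Arguments.
Unset Strict Implicit.
Unset Printing Implicit Defensive.

Import GRing.Theory.
Local Open Scope ring_scope.

(** The map [ad Y] is a derivation that kills the polynomials in [Y], and the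
first two Askey-Wilson relations express [ad Y X] and [ad Y Z] as combinations
of [X], [Z] and 1 with coefficients in [C[Y]].  Hence
[ad_Y^n X = U_n(Y) X + V_n(Y) Z + W_n(Y)] by induction on [n].  Comparing the
coefficients of [t ^ n] in the linear system forces [E_1 = \sum U_n t ^ n / n!]
and [E_2 = \sum V_n t ^ n / n!], and then [E_0 = \sum W_n t ^ n / n!]. *)

Lemma adD (A : nzRingType) (Y B C : A) : ad Y (B + C) = ad Y B + ad Y C.
Proof. by rewrite /ad mulrDr mulrDl opprD addrACA. Qed.

Lemma ad_comm (A : nzRingType) (Y B : A) : GRing.comm Y B -> ad Y B = 0.
Proof. by move=> YB; rewrite /ad YB subrr. Qed.

Lemma ad_comml (A : nzRingType) (Y B C : A) :
  GRing.comm Y B -> ad Y (B * C) = B * ad Y C.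
Proof. by move=> YB; rewrite /ad mulrBr !mulrA YB. Qed.

(** Evaluation at [Y] is a ring morphism, so it carries the commutation of ['X] with [p] over to
    [A]. *)
Lemma comm_horner_alg (K : fieldType) (A : algType K) (Y : A) (p : {poly K}) :
  GRing.comm Y (horner_alg Y p).
Proof.
have := congr1 (horner_alg Y) (mulrC 'X p).
by rewrite !rmorphM /= horner_algX.
Qed.

Section AskeyWilson.
Variables (K : fieldType) (A : algType K) (q C1 C2 C3 : K) (X Y Z : A).
Hypotheses (hq : q != 0) (hXYZ : askey_wilson q C1 C2 C3 X Y Z).

Lemma askey_wilson_adX : ad Y X = (1 - q) *: (Y * X) - Z - C3%:A.
Proof.
case: hXYZ => h _ _.
by rewrite -addrA -opprD -h scalerBl scale1r opprB addrA subrK.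
Qed.

(** Dividing the second relation by [q] expresses [Z * Y] through [Y * Z], [X] and 1. *)
Lemma askey_wilson_adZ :
  ad Y Z = (1 - q^-1) *: (Y * Z) + q^-1 *: X + (C1 * q^-1)%:A.
Proof.
case: hXYZ => _ h _.
rewrite [C1 * _]mulrC -scalerA -addrA -scalerDr -h scalerBr scalerA mulVf //.
by rewrite scale1r scalerBl scale1r addrA subrK.
Qed.

Lemma iter_adX n :
  iter n (ad Y) X =
    horner_alg Y (U_ q n) * X + horner_alg Y (V_ q n) * Z
    + horner_alg Y (W_ q C1 C3 n).
Proof.
elim: n => [|n IHn] /=; first by rewrite rmorph1 rmorph0 mul1r mul0r !addr0.
rewrite IHn !adD [ad Y (horner_alg _ (W_ _ _ _ _))]ad_comm; last first.
  exact: comm_horner_alg.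
rewrite !ad_comml; try exact: comm_horner_alg.
rewrite askey_wilson_adX askey_wilson_adZ addr0.
rewrite !(linearD, linearN, linearZ) /= !rmorphM /= horner_algX.
have Yu := comm_horner_alg Y (U_ q n); have Yv := comm_horner_alg Y (V_ q n).
(* From here on, only the commutation of [u] and [v] with [Y] matters. *)
move: (horner_alg Y (U_ q n)) (horner_alg Y (V_ q n)) Yu Yv => u v Yu Yv.
rewrite !(mulrDr, mulrDl, mulrN, mulNr) -!scalerAl -!scalerAr !mulr1 !mulrA.
rewrite !(mulrN, mulr1, mul1r) Yu Yv scalerN scaleNr.
(* Both sides are now sums of the same six terms; only their order differs. *)
rewrite -!addrA; congr (_ + _).
by rewrite [RHS]addrCA; congr (_ + _); rewrite [LHS]addrCA [RHS]addrCA;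
  congr (_ + _); rewrite addrCA.
Qed.

End AskeyWilson.

Section Series.
Variables (K : fieldType) (q C1 C3 : K).
Hypothesis K0 : [pchar K] =i pred0.

Lemma natrS_neq0 n : n.+1%:R != 0 :> K.
Proof. by rewrite ((pcharf0P K).1 K0). Qed.

Lemma mulrSn_inj (V : lmodType K) n : injective (fun v : V => v *+ n.+1).
Proof.
by move=> u v; rewrite -!scaler_nat => /scalerI; apply; exact: natrS_neq0.
Qed.

Lemma invr_factS n : (n.+1`!%:R : K)^-1 = n.+1%:R^-1 * n`!%:R^-1.
Proof. by rewrite factS natrM invfM. Qed.

(** The exponential generating function: in characteristic 0, [fps_deriv] shifts its sequence by
    one, so recurrences become differential equations. *)
Definition egf (V : lmodType K) (p : nat -> V) : fps V :=
  fun n => n`!%:R^-1 *: p n.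

Lemma fps_deriv_egf (V : lmodType K) (p : nat -> V) :
  fps_deriv (egf p) = egf (fun n => p n.+1).
Proof.
apply/funext => n; rewrite /fps_deriv /egf invr_factS -scalerA -scaler_nat.
by rewrite scalerKV ?natrS_neq0.
Qed.

Lemma E_system_egf : E_system q (egf (U_ q)) (egf (V_ q)).
Proof.
split; rewrite ?fps_deriv_egf /egf /= ?invr1 ?scale1r ?scaler0 //;
  apply/funext => n /=; rewrite -scalerAl -scalerAr scalerDr ?scalerN !scalerA.
  by rewrite ![n`!%:R^-1 * _]mulrC.
by rewrite [n`!%:R^-1 * _]mulrC.
Qed.

(** The system fixes [n.+1] times each coefficient of index [n.+1] by those of index [n], and [n.+1]
    is invertible; the equivalence gives existence and uniqueness together. *)
Lemma E_systemP (E1 E2 : fps {poly K}) :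
  E_system q E1 E2 <-> E1 = egf (U_ q) /\ E2 = egf (V_ q).
Proof.
split=> [[h1 h2 E10 E20]|[-> ->]]; last exact: E_system_egf.
case: E_system_egf => g1 g2 U0 V0.
suff E n : E1 n = egf (U_ q) n /\ E2 n = egf (V_ q) n.
  by split; apply/funext => n; case: (E n).
elim: n => [|n [IH1 IH2]]; first by rewrite E10 E20 U0 V0.
split; apply: (@mulrSn_inj _ n) => /=.
  (* By induction, the equations for the two solutions have equal right-hand sides at index [n]. *)
  by move: (congr1 (@^~ n) h1) (congr1 (@^~ n) g1); rewrite /= IH1 IH2 => <-.
by move: (congr1 (@^~ n) h2) (congr1 (@^~ n) g2); rewrite /= IH1 IH2 => <-.
Qed.

(** Integration shifts the index back by one, matching the recurrence of [W_]; the zero constant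
    term matches the value 0 of [W_] at 0. *)
Lemma E0_series_egf :
  E0_series q C1 C3 (egf (U_ q)) (egf (V_ q)) = egf (W_ q C1 C3).
Proof.
apply/funext => -[|n]; rewrite /E0_series /egf /=.
  by rewrite !scaler0 addr0.
rewrite invr_factS scalerDr !scalerA.
by congr (_ *: _ + _ *: _); rewrite mulrC.
Qed.

End Series.

Theorem mainTheorem2 (R : realType) (A : algType R[i]) (q C1 C2 C3 : R[i])
    (X Y Z : A) (hq : q != 0) (hXYZ : askey_wilson q C1 C2 C3 X Y Z) :
  [/\ forall n : nat,
        iter n (ad Y) X =
          horner_alg Y (U_ q n) * X + horner_alg Y (V_ q n) * Z
          + horner_alg Y (W_ q C1 C3 n),
      exists! E : fps {poly R[i]} * fps {poly R[i]}, E_system q E.1 E.2 &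
      forall E1 E2 : fps {poly R[i]}, E_system q E1 E2 ->
        exp_conj Y X =
          X \o* fps_eval E1 Y \+ Z \o* fps_eval E2 Y
          \+ fps_eval (E0_series q C1 C3 E1 E2) Y].
Proof.
have K0 : [pchar R[i]] =i pred0 by exact: Num.Theory.pchar_num.
have adX := iter_adX hq hXYZ.
split=> //.
  exists (egf (U_ q), egf (V_ q)); split=> [|[E1 E2] /=].
    exact/E_systemP.
  by move/(E_systemP _ K0) => [-> ->].
move=> E1 E2 /(E_systemP _ K0)[-> ->]; rewrite E0_series_egf //.
apply/funext => n; rewrite /exp_conj adX /= /fps_eval /egf !linearZ /=.
by rewrite !mulr_algl !scalerDr !scalerAl.
Qed.
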